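(* Let $f,K'\in\mathbb{R}[x,y,z]$ and $\beta,\gamma\in\mathbb{R}$, put $K=K'z$ with $\deg f,\deg K\leq 2$, and suppose that $\chi=(P,Q,R)$ is the cubic vector field on $\mathbb{T}^2$ given by $$P=\tfrac14 Kx+fy+\beta z,\qquad Q=\tfrac14 Ky-fx+\gamma z,$$ $$R=\tfrac12 K'\big(-a^2(x^2+y^2)+z^2+a^4-1\big)-2(\beta x+\gamma y)(x^2+y^2-a^2).$$ Let $a_i,b_i\in\mathbb{R}$ with $(a_i,b_i)\neq(0,0)$, $i=1,2$. Then $\chi$ has exactly four invariant meridians given by the planes $a_ix+b_iy=0$ for $i=1,2$ if and only if $f=c\prod_{i=1}^2(a_ix+b_iy)$ for some $c\in\mathbb{R}\setminus\{0\}$ and $\beta=\gamma=0$.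
   Context: Fix a real number $a>1$ and let $\mathbb{T}^2=\{(x,y,z)\in\mathbb{R}^3:(x^2+y^2-a^2)^2+z^2-1=0\}$. A triple $\chi=(P,Q,R)$ with $P,Q,R\in\mathbb{R}[x,y,z]$ denotes the polynomial vector field $P\frac{\partial}{\partial x}+Q\frac{\partial}{\partial y}+R\frac{\partial}{\partial z}$ in $\mathbb{R}^3$, acting on polynomials as a derivation; its degree is $\max\{\deg P,\deg Q,\deg R\}$, and it is cubic if its degree is $3$. An algebraic surface $\{g=0\}$ is invariant for $\chi$ if $\chi g=Lg$ for some $L\in\mathbb{R}[x,y,z]$; $\chi$ is a vector field on $\mathbb{T}^2$ if $\{(x^2+y^2-a^2)^2+z^2-1=0\}$ is invariant in this sense. A meridian plane is a plane $\{\lambda x+\mu y=0\}$ with $(\lambda,\mu)\in\mathbb{R}^2\setminus\{(0,0)\}$; it cuts $\mathbb{T}^2$ in two curves, called meridians. A meridian is invariant if its meridian plane is invariant for $\chi$. The multiplicity of an invariant meridian plane $\{\lambda x+\mu y=0\}$ is the largest $k$ such that $(\lambda x+\mu y)^k$ divides the extactic polynomial $\mathcal{E}_{\langle x,y\rangle}(\chi)=\begin{vmatrix}x&y\\ \chi(x)&\chi(y)\end{vmatrix}=xQ-yP$ if this is nonzero, and infinite otherwise. Invariant meridians are counted with multiplicity: an invariant meridian plane of multiplicity $k$ contributes $2k$ meridians (so the two planes in the claim may coincide, in which case that plane has multiplicity two). *)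

(* Defs.v *)
From HB Require Import structures.
From mathcomp Require Import all_boot all_order all_algebra.
From mathcomp Require Import classical_sets functions reals mpoly.

Set Implicit Arguments.
Unset Strict Implicit.
Unset Printing Implicit Defensive.

Import Order.TTheory GRing.Theory Num.Theory.
Local Open Scope ring_scope.

Definition px (R : realType) : {mpoly R[3]} := 'X_(0 : 'I_3).
Definition py (R : realType) : {mpoly R[3]} := 'X_(1 : 'I_3).
Definition pz (R : realType) : {mpoly R[3]} := 'X_(2 : 'I_3).
Arguments px {R}.
Arguments py {R}.
Arguments pz {R}.

Definition mpoly_dvd (R : realType) (p q : {mpoly R[3]}) : Prop :=
  exists r : {mpoly R[3]}, q = r * p.

Record vfield (R : realType) := VField {
  vfP : {mpoly R[3]};
  vfQ : {mpoly R[3]};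
  vfR : {mpoly R[3]} }.

Definition vf_act (R : realType) (chi : vfield R) (g : {mpoly R[3]}) :
    {mpoly R[3]} :=
  vfP chi * g^`M(0) + vfQ chi * g^`M(1) + vfR chi * g^`M(2).

(* [msize p] is one more than the degree of [p], and [msize 0 = 0]. *)
Definition mpoly_deg_le (R : realType) (p : {mpoly R[3]}) (d : nat) : bool :=
  (msize p <= d.+1)%N.

Definition cubic_vf (R : realType) (chi : vfield R) : bool :=
  maxn (msize (vfP chi)) (maxn (msize (vfQ chi)) (msize (vfR chi))) == 4%N.

Definition invariant_surface (R : realType) (chi : vfield R)
    (g : {mpoly R[3]}) : Prop :=
  exists L : {mpoly R[3]}, vf_act chi g = L * g.

Definition torus_poly (R : realType) (a : R) : {mpoly R[3]} :=
  (px ^+ 2 + py ^+ 2 - (a ^+ 2)%:MP) ^+ 2 + pz ^+ 2 - 1.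

Definition vf_on_torus (R : realType) (a : R) (chi : vfield R) : Prop :=
  invariant_surface chi (torus_poly a).

Definition meridian_form (R : realType) (u : R * R) : {mpoly R[3]} :=
  u.1 *: px + u.2 *: py.

(* The plane itself, as a set of points of R^3: two normals give the same
   plane iff they are proportional. *)
Definition meridian_plane (R : realType) (u : R * R) : set ('I_3 -> R) :=
  [set v | (meridian_form u).@[v] = 0]%classic.

Definition extactic (R : realType) (chi : vfield R) : {mpoly R[3]} :=
  px * vf_act chi py - py * vf_act chi px.

(* [k] is the finite multiplicity of the plane with normal [u]; there is no
   such [k] when the extactic polynomial vanishes (infinite multiplicity). *)
Definition meridian_multiplicity (R : realType) (chi : vfield R)
    (u : R * R) (k : nat) : Prop :=
  [/\ extactic chi <> 0,
      mpoly_dvd (meridian_form u ^+ k) (extactic chi)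
    & forall j : nat,
        mpoly_dvd (meridian_form u ^+ j) (extactic chi) -> (j <= k)%N].

Definition invariant_meridian_planes (R : realType) (chi : vfield R) :
    set (set ('I_3 -> R)) :=
  [set H | exists u : R * R,
     [/\ u <> (0, 0), H = meridian_plane u
       & invariant_surface chi (meridian_form u)]]%classic.

(* The number of invariant meridians, counted with multiplicity, is finite and
   equal to [N]: [u] enumerates without repetition normals of the invariant
   meridian planes, and [k i] is the multiplicity of the [i]-th plane. *)
Definition invariant_meridian_number (R : realType) (chi : vfield R)
    (N : nat) : Prop :=
  exists (n : nat) (u : 'I_n -> R * R) (k : 'I_n -> nat),
    [/\ forall i, u i <> (0, 0),
        injective (fun i => meridian_plane (u i)),
        invariant_meridian_planes chi = range (fun i => meridian_plane (u i)),
        forall i, meridian_multiplicity chi (u i) (k i)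
      & N = (\sum_(i < n) 2 * k i)%N].

(* Main.v *)
(* Write l_u = u1 x + u2 y. Substituting for (x, y) its orthogonal projection
   onto the line l_u = 0 is a ring morphism [plane_restr u] into an integral
   domain whose kernel is the ideal generated by l_u. The image of chi(l_u)
   under it is (f restricted) * (u1 y - u2 x) + (beta u1 + gamma u2) z, and
   specializing to x = y = 0 shows that l_u is invariant iff l_u divides f and
   beta u1 + gamma u2 = 0. Two distinct invariant planes thus force
   beta = gamma = 0 and, by degree, f = c l_u l_v. For a double plane the same
   specialization is applied to the quotient by l_u of the extactic polynomial
   (gamma x - beta y) z - f (x^2 + y^2). Conversely x^2 + y^2 is coprime to
   every l_u, so for beta = gamma = 0 the meridian factors of the extactic
   polynomial are those of f. *)

From HB Require Import structures.
Require Import Defs.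
From mathcomp Require Import all_boot all_order all_algebra.
From mathcomp Require Import classical_sets functions reals mpoly zify ring.

Import GRing.Theory Num.Theory.
Local Open Scope ring_scope.

(** * Restriction of polynomials to a meridian plane *)

Section MeridianPlane.
Variable R : realType.
Implicit Types (u v : R * R) (p q : {mpoly R[3]}).

Definition sqnorm u : R := u.1 ^+ 2 + u.2 ^+ 2.

Lemma sqnorm_neq0 u : u <> (0, 0) -> sqnorm u != 0.
Proof.
case: u => u1 u2 u_neq0; apply/eqP => /eqP.
rewrite /sqnorm/= paddr_eq0 ?sqr_ge0// !sqrf_eq0.
by move=> /andP[/eqP u10 /eqP u20]; apply: u_neq0; rewrite u10 u20.
Qed.

(** The form of the perpendicular meridian plane, which serves as a coordinate along the plane l_u =
    0. *)
Definition transverse_form u : {mpoly R[3]} := meridian_form (- u.2, u.1).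

Definition plane_restr u : {mpoly R[3]} -> {mpoly R[3]} :=
  comp_mpoly [tuple (- u.2 / sqnorm u) *: transverse_form u;
                    (u.1 / sqnorm u) *: transverse_form u; pz].

HB.instance Definition _ u := GRing.RMorphism.on (plane_restr u).

Lemma plane_restr_px u :
  plane_restr u px = (- u.2 / sqnorm u) *: transverse_form u.
Proof. exact: comp_mpolyXU. Qed.

Lemma plane_restr_py u :
  plane_restr u py = (u.1 / sqnorm u) *: transverse_form u.
Proof. exact: comp_mpolyXU. Qed.

Lemma plane_restr_pz u : plane_restr u pz = pz.
Proof. exact: comp_mpolyXU. Qed.

Lemma plane_restrZ u c p : plane_restr u (c *: p) = c *: plane_restr u p.
Proof. exact: comp_mpolyZ. Qed.

(** The projection has direction (-u2, u1), on which l_v takes the value det(u, v); parallel normals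
    are thus detected by restriction. *)
Lemma plane_restr_form u v : plane_restr u (meridian_form v)
  = ((u.1 * v.2 - u.2 * v.1) / sqnorm u) *: transverse_form u.
Proof.
rewrite rmorphD/= !plane_restrZ plane_restr_px plane_restr_py !scalerA -scalerDl.
by congr (_ *: _); ring.
Qed.

Lemma plane_restr_sqnorm u : u <> (0, 0) ->
  plane_restr u (px ^+ 2 + py ^+ 2) = (sqnorm u)^-1 *: transverse_form u ^+ 2.
Proof.
move=> /sqnorm_neq0 u_neq0.
rewrite rmorphD !rmorphXn/= plane_restr_px plane_restr_py !exprZn -scalerDl.
congr (_ *: _).
rewrite !exprMn sqrrN -mulrDl [u.2 ^+ 2 + _]addrC -/(sqnorm u).
by rewrite expr2 mulrA mulfV// mul1r.
Qed.

Lemma meval_form u (x : 'I_3 -> R) :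
  (meridian_form u).@[x] = u.1 * x 0 + u.2 * x 1.
Proof. by rewrite mevalD !mevalZ !mevalXU. Qed.

Lemma meridian_form_neq0 u : u <> (0, 0) -> meridian_form u != 0.
Proof.
move=> /sqnorm_neq0 u_neq0; apply/eqP => /(congr1 (fun p => p.@[fun i =>
  if i == 0 then u.1 else u.2])).
by rewrite meval_form/= meval0 -!expr2; apply/eqP.
Qed.

Lemma transverse_form_neq0 u : u <> (0, 0) -> transverse_form u != 0.
Proof.
case: u => u1 u2 u_neq0; apply: meridian_form_neq0 => -[/eqP].
by rewrite oppr_eq0 => /eqP u20 u10; apply: u_neq0; rewrite u10 u20.
Qed.

(** The polynomials with this property are closed under linear combinations and products, so
    checking the three variables suffices. *)
Lemma dvd_sub_plane_restr u p : u <> (0, 0) ->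
  mpoly_dvd (meridian_form u) (p - plane_restr u p).
Proof.
move=> u_neq0; have Nu : sqnorm u * (sqnorm u)^-1 = 1.
  by rewrite mulfV// sqnorm_neq0.
have dvdM q1 q2 : mpoly_dvd (meridian_form u) (q1 - plane_restr u q1) ->
    mpoly_dvd (meridian_form u) (q2 - plane_restr u q2) ->
    mpoly_dvd (meridian_form u) (q1 * q2 - plane_restr u (q1 * q2)).
  (* With a bar for the restriction: q1 q2 - q1' q2' = (q1 - q1') q2 + q1' (q2 - q2'), the prime
     standing for the bar. *)
  move=> [r1 e1] [r2 e2]; exists (r1 * q2 + plane_restr u q1 * r2).
  rewrite rmorphM mulrDl -[_ * r2 * _]mulrA -e2 mulrAC -e1; ring.
have dvdX i : mpoly_dvd (meridian_form u) ('X_i - plane_restr u 'X_i).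
  have: i \in [:: 0; 1; 2] by case: i => -[|[|[]]].
  rewrite !inE => /or3P[] /eqP ->.
  (* What the projection removes from (x, y) is its normal component (l_u / N) u, with N =
     [sqnorm u]. *)
  - exists (u.1 / sqnorm u)%:MP; rewrite plane_restr_px.
    rewrite /transverse_form /meridian_form/= -!mul_mpolyC.
    rewrite -[X in X - _]mul1r -mpolyC1 -Nu -/(@px R) /sqnorm; ring.
  - exists (u.2 / sqnorm u)%:MP; rewrite plane_restr_py.
    rewrite /transverse_form /meridian_form/= -!mul_mpolyC.
    rewrite -[X in X - _]mul1r -mpolyC1 -Nu -/(@py R) /sqnorm; ring.
  - by exists 0; rewrite plane_restr_pz subrr mul0r.
elim/mpolyind: p => [|c m p _ _ [r e]].
  by exists 0; rewrite rmorph0 subrr mul0r.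
have [s es] : mpoly_dvd (meridian_form u) ('X_[m] - plane_restr u 'X_[m]).
  rewrite mpolyXE_id; elim/big_ind: _ => [| |i _]; last first.
  - elim: (m i) => [|k IHk]; last by rewrite exprS; apply: dvdM.
    by exists 0; rewrite expr0 rmorph1 subrr mul0r.
  - exact: dvdM.
  - by exists 0; rewrite rmorph1 subrr mul0r.
exists (c *: s + r); rewrite rmorphD/= plane_restrZ mulrDl -e -scalerAl -es.
by rewrite scalerBr; ring.
Qed.

Lemma dvd_formP u p : u <> (0, 0) ->
  mpoly_dvd (meridian_form u) p <-> plane_restr u p = 0.
Proof.
move=> u_neq0; split=> [[r ->]|p0].
  by rewrite rmorphM/= plane_restr_form mulrC [u.2 * _]mulrC subrr mul0r scale0r mul0r.
by have := @dvd_sub_plane_restr u p u_neq0; rewrite p0 subr0.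
Qed.

(** * Normals, linear forms and multiplicities *)

Lemma plane_eqP u v : u <> (0, 0) -> v <> (0, 0) ->
  meridian_plane u = meridian_plane v <-> u.1 * v.2 = u.2 * v.1.
Proof.
have sub u' v' : u' <> (0, 0) -> u'.1 * v'.2 = u'.2 * v'.1 ->
    (meridian_plane u' `<=` meridian_plane v')%classic.
  move=> /sqnorm_neq0 u_neq0 uv x; rewrite /meridian_plane/= !meval_form => x0.
  apply: (mulfI u_neq0); rewrite mulr0 /sqnorm.
  (* N l_v is expanded in the orthogonal basis formed by l_u and its transverse form. *)
  transitivity ((u'.1 * v'.1 + u'.2 * v'.2) * (u'.1 * x 0 + u'.2 * x 1)
      + (u'.1 * v'.2 - u'.2 * v'.1) * (u'.1 * x 1 - u'.2 * x 0)); first by ring.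
  by rewrite x0 uv subrr mulr0 mul0r addr0.
move=> u_neq0 v_neq0; split=> [uv|uv]; last first.
  by apply/seteqP; split; apply: sub => //; rewrite mulrC -uv mulrC.
have : meridian_plane u (fun i => if i == 0 then - u.2 else u.1).
  by rewrite /meridian_plane/= meval_form/=; ring.
rewrite uv /meridian_plane/= meval_form/= => /eqP.
by rewrite mulrN addrC subr_eq0 mulrC => /eqP ->; rewrite mulrC.
Qed.

Lemma msize_form_ge2 u : u <> (0, 0) -> (2 <= msize (meridian_form u))%N.
Proof.
move=> u_neq0; rewrite ltnNge; apply/negP => /msize1_polyC e.
have := congr1 (fun p => p.@[fun=> 0]) e.
rewrite meval_form !mulr0 addr0 mevalC => /esym c0.
by move: (meridian_form_neq0 _ u_neq0); rewrite e c0 mpolyC0 eqxx.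
Qed.

(** A cofactor that does not vanish on the plane certifies maximality: a power j > k would, after
    cancelling the k-th power, make l_u divide q. *)
Lemma multiplicityP (chi : vfield R) u k q : u <> (0, 0) ->
  extactic chi = q * meridian_form u ^+ k -> plane_restr u q != 0 ->
  meridian_multiplicity chi u k.
Proof.
move=> u_neq0 e q0; split.
- rewrite e; apply/eqP; rewrite mulf_neq0 ?expf_neq0 ?meridian_form_neq0//.
  by apply: contraNneq q0 => ->; rewrite rmorph0.
- by exists q.
- move=> j [r er]; rewrite leqNgt; apply/negP => ltkj; move/negP: q0; apply.
  apply/eqP/dvd_formP => //; exists (r * meridian_form u ^+ (j - k.+1)).
  apply: (mulIf (expf_neq0 k (meridian_form_neq0 _ u_neq0))).
  by rewrite -e er -!mulrA -exprS -exprD subnK.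
Qed.

Lemma plane_restr_transverse u : u <> (0, 0) ->
  plane_restr u (transverse_form u) = transverse_form u.
Proof.
move=> /sqnorm_neq0 u_neq0; rewrite plane_restr_form/=.
by rewrite mulrN opprK -!expr2 mulfV// scale1r.
Qed.

Lemma plane_restr_form_eq0 u v : u <> (0, 0) ->
  plane_restr u (meridian_form v) = 0 <-> u.1 * v.2 = u.2 * v.1.
Proof.
move=> u_neq0; rewrite plane_restr_form; split=> [/eqP|->]; last first.
  by rewrite subrr mul0r scale0r.
rewrite scaler_eq0 (negPf (transverse_form_neq0 _ u_neq0)) orbF.
by rewrite mulf_eq0 invr_eq0 (negPf (sqnorm_neq0 _ u_neq0)) orbF subr_eq0 => /eqP.
Qed.

Lemma parallel_form u v : u <> (0, 0) -> v <> (0, 0) -> u.1 * v.2 = u.2 * v.1 ->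
  exists2 s, s != 0 & meridian_form v = s *: meridian_form u.
Proof.
move=> u_neq0 v_neq0 uv; have Nu := sqnorm_neq0 _ u_neq0.
(* The scalar is the coefficient of the orthogonal projection of v onto u. *)
have e : meridian_form v
    = ((u.1 * v.1 + u.2 * v.2) / sqnorm u) *: meridian_form u.
  rewrite /meridian_form scalerDr !scalerA; congr (_ *: _ + _ *: _).
    apply: (mulIf Nu); rewrite mulrAC mulfVK// /sqnorm.
    rewrite mulrDl -[u.2 * v.2 * _]mulrA [v.2 * _]mulrC uv; ring.
  apply: (mulIf Nu); rewrite mulrAC mulfVK// /sqnorm.
  rewrite mulrDl -[u.1 * v.1 * _]mulrA [v.1 * _]mulrC -uv; ring.
exists ((u.1 * v.1 + u.2 * v.2) / sqnorm u) => //.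
by apply: contraNneq (meridian_form_neq0 _ v_neq0); rewrite e => ->; rewrite scale0r.
Qed.

(** * Action of a vector field on linear forms *)

Lemma mderivXU (i j : 'I_3) : ('X_i : {mpoly R[3]})^`M(j) = (i == j)%:R.
Proof.
rewrite mderivX mnm1E; case: eqVneq => [->|_]; last by rewrite scale0r.
rewrite (_ : (_ - _)%MM = 0%MM) ?mpolyX0 ?scale1r//.
by apply/mnmP => l; rewrite mnmBE mnm0E subnn.
Qed.

Lemma vf_actZ (chi : vfield R) c p : vf_act chi (c *: p) = c *: vf_act chi p.
Proof. by rewrite /vf_act !mderivZ -!scalerAr -!scalerDr. Qed.

Lemma vf_act_form (chi : vfield R) u :
  vf_act chi (meridian_form u) = u.1 *: vfP chi + u.2 *: vfQ chi.
Proof.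
rewrite /vf_act !mderivD !mderivZ !mderivXU/= !scaler0 !addr0 add0r mulr0 addr0.
by rewrite -!scalerAr !mulr1.
Qed.

Lemma extacticE (chi : vfield R) : extactic chi = px * vfQ chi - py * vfP chi.
Proof.
by rewrite /extactic /vf_act !mderivXU/= !mulr0 !mulr1 !addr0 add0r.
Qed.

(** Invariance does not depend on the chosen normal, since two normals of one plane differ by a
    nonzero scalar. *)
Lemma invariant_meridian_planeP (chi : vfield R) u : u <> (0, 0) ->
  invariant_meridian_planes chi (meridian_plane u) <->
  invariant_surface chi (meridian_form u).
Proof.
move=> u_neq0; split=> [[v [v_neq0 uv [L eL]]]|]; last by exists u.
have [s _ e] : exists2 s, s != 0 & meridian_form u = s *: meridian_form v.
  by apply: parallel_form => //; apply/plane_eqP.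
by exists L; rewrite e vf_actZ eL scalerAr.
Qed.

(** * Invariance and double planes for the given field *)

Section MeridianField.
Variables (f K T : {mpoly R[3]}) (beta gamma : R).
Let chi := VField (4^-1 *: (K * px) + f * py + beta *: pz)
                  (4^-1 *: (K * py) - f * px + gamma *: pz) T.

(** The K-part of the field is radial in (x, y), so it cancels in the determinant. *)
Lemma extactic_meridian : extactic chi
  = (gamma *: px - beta *: py) * pz - f * (px ^+ 2 + py ^+ 2).
Proof. rewrite extacticE/= -!mul_mpolyC; ring. Qed.

(* On the axis of rotation [transverse_form u] vanishes while [pz] does not. *)
Lemma transverse_pz_eq0 u p c : u <> (0, 0) ->
  p * transverse_form u + c *: pz = 0 -> p = 0 /\ c = 0.
Proof.
move=> u_neq0 e; suff c0 : c = 0.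
  split=> //; move: e; rewrite c0 scale0r addr0 => /eqP.
  by rewrite mulf_eq0 (negPf (transverse_form_neq0 _ u_neq0)) orbF => /eqP.
have := congr1 (fun q => q.@[fun i => if i == 2 then 1 else 0]) e.
by rewrite mevalD mevalM mevalZ meval_form mevalXU/= meval0 !mulr0 addr0 mulr0
  add0r mulr1.
Qed.

Lemma invariant_formP u : u <> (0, 0) ->
  invariant_surface chi (meridian_form u) <->
  plane_restr u f = 0 /\ beta * u.1 + gamma * u.2 = 0.
Proof.
move=> u_neq0; rewrite -[invariant_surface _ _]/(mpoly_dvd _ _) dvd_formP//.
(* The radial part contributes a multiple of l_u, which vanishes on the plane; only the second
   summand has to be tested. *)
have -> : vf_act chi (meridian_form u) = (4^-1 *: K) * meridian_form u
    + (f * transverse_form u + (beta * u.1 + gamma * u.2) *: pz).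
  rewrite vf_act_form/= /transverse_form /meridian_form/= -!mul_mpolyC; ring.
rewrite !rmorphD !rmorphM/= !plane_restrZ plane_restr_transverse//.
have -> : plane_restr u (meridian_form u) = 0.
  by apply/plane_restr_form_eq0 => //; rewrite mulrC.
rewrite mulr0 add0r plane_restr_pz; split; first exact: transverse_pz_eq0.
by case=> -> ->; rewrite mul0r scale0r addr0.
Qed.

Lemma dvd_sqr_extactic u : u <> (0, 0) ->
  invariant_surface chi (meridian_form u) ->
  mpoly_dvd (meridian_form u ^+ 2) (extactic chi) ->
  [/\ beta = 0, gamma = 0 & mpoly_dvd (meridian_form u ^+ 2) f].
Proof.
move=> u_neq0 /invariant_formP [//|/dvd_formP [//|g fE] bg] [r].
(* As beta u1 + gamma u2 = 0, the vector (gamma, -beta) is parallel to u; with s its inner product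
   with u, N (gamma x - beta y) = s l_u. *)
rewrite extactic_meridian => rE; set N := sqnorm u; set s := gamma * u.1 - beta * u.2.
have N_neq0 : N != 0 by apply: sqnorm_neq0.
have gammaE : N * gamma = s * u.1.
  by rewrite -[RHS]addr0 -(mul0r u.2) -bg /N /s /sqnorm; ring.
have betaE : N * beta = - s * u.2.
  by rewrite -[RHS]addr0 -(mul0r u.1) -bg /N /s /sqnorm; ring.
(* The identity for the extactic polynomial, multiplied by N and divided once by l_u. *)
have e : s *: pz - N *: (g * (px ^+ 2 + py ^+ 2)) = N *: r * meridian_form u.
  apply: (mulIf (meridian_form_neq0 _ u_neq0)).
  transitivity (N *: (r * meridian_form u ^+ 2)); last first.
    by rewrite -!mul_mpolyC; ring.
  rewrite -rE fE mulrBl scalerBr; congr (_ - _); last first.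
    by rewrite -!mul_mpolyC; ring.
  rewrite scalerAl scalerBr !scalerA gammaE betaE /meridian_form.
  by rewrite -!mul_mpolyC; ring.
have := congr1 (plane_restr u) e.
rewrite rmorphB rmorphM/= !plane_restrZ rmorphM/= plane_restr_pz.
rewrite plane_restr_sqnorm// -scalerAr scalerA mulfV// scale1r.
have -> : plane_restr u (meridian_form u) = 0.
  by apply/plane_restr_form_eq0 => //; rewrite mulrC.
(* On the plane, N (x^2 + y^2) is the square of the transverse form t, leaving s z - g t^2 = 0 with
   g restricted. Hence s = 0 and l_u divides g. *)
rewrite mulr0 expr2 mulrA -mulNr addrC => /transverse_pz_eq0 [//|/eqP].
rewrite oppr_eq0 mulf_eq0 (negPf (transverse_form_neq0 _ u_neq0)) orbF.
move=> /eqP/dvd_formP [//|h gE] s0; split.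
- by apply: (mulfI N_neq0); rewrite betaE s0 oppr0 mul0r mulr0.
- by apply: (mulfI N_neq0); rewrite gammaE s0 mul0r mulr0.
- by exists h; rewrite fE gE expr2 mulrA.
Qed.

End MeridianField.

(** Each form has degree at least one, so the degree bound leaves a constant cofactor. *)
Lemma scalar_multiple_of_forms u v f : u <> (0, 0) -> v <> (0, 0) ->
  mpoly_deg_le f 2 -> mpoly_dvd (meridian_form u * meridian_form v) f ->
  exists c, f = c *: (meridian_form u * meridian_form v).
Proof.
move=> u_neq0 v_neq0 + [r fE]; rewrite /mpoly_deg_le fE.
(* Sizes add up, minus one, only for nonzero factors, so r = 0 is treated apart. *)
have [->|r_neq0] := eqVneq r 0; first by exists 0; rewrite mul0r scale0r.
rewrite !msizeM ?mulf_neq0 ?meridian_form_neq0// => sz.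
exists (r@_0%MM); rewrite -mul_mpolyC -msize1_polyC//.
have := msize_form_ge2 _ u_neq0; have := msize_form_ge2 _ v_neq0.
by move: sz; do 3!move: (mmeasure _ _) => ?; lia.
Qed.

Lemma ord2_cases (i : 'I_2) : i = ord0 \/ i = ord_max.
Proof. by case: i => -[|[|//]] ?; [left|right]; apply: val_inj. Qed.

Lemma range_ord2 (S : Type) (F : 'I_2 -> S) :
  (range F = [set F ord0; F ord_max])%classic.
Proof.
apply/seteqP; split=> [_ [i _ <-]|_ [] ->]; [|by exists ord0|by exists ord_max].
by case: (ord2_cases i) => ->; [left|right].
Qed.

(** * The two implications for a pair of planes *)

Section TwoPlanes.
Variables (f K T : {mpoly R[3]}) (beta gamma : R) (u v : R * R).
Hypotheses (u_neq0 : u <> (0, 0)) (v_neq0 : v <> (0, 0)).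
Let chi := VField (4^-1 *: (K * px) + f * py + beta *: pz)
                  (4^-1 *: (K * py) - f * px + gamma *: pz) T.

Lemma four_meridians_necessary : mpoly_deg_le f 2 ->
  invariant_meridian_number chi 4 ->
  (invariant_meridian_planes chi
    = [set meridian_plane u; meridian_plane v])%classic ->
  (exists c, c <> 0 /\ f = c *: (meridian_form u * meridian_form v))
  /\ beta = 0 /\ gamma = 0.
Proof.
move=> degf [n [w [k [w_neq0 w_inj wE km k4]]]] uvE.
have inv x : x <> (0, 0) ->
    ([set meridian_plane u; meridian_plane v] (meridian_plane x))%classic ->
    invariant_surface chi (meridian_form x).
  by move=> x_neq0; rewrite -uvE => /invariant_meridian_planeP; apply.
(* A total of 4 forces a nonempty enumeration, and finite multiplicity of its first plane includes
   nonvanishing. *)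
have extactic_neq0 : extactic chi <> 0.
  case: n w k {w_neq0 w_inj wE} km k4 => [|n] w k km k4; last by case: (km ord0).
  by rewrite big_ord0 in k4.
suff [beta0 gamma0 /(scalar_multiple_of_forms _ _ _ u_neq0 v_neq0 degf) [c fE]] :
    [/\ beta = 0, gamma = 0 & mpoly_dvd (meridian_form u * meridian_form v) f].
  do !split=> //; exists c; split=> // c0; apply: extactic_neq0.
  rewrite extactic_meridian fE c0 beta0 gamma0; rewrite !scale0r; ring.
have invu := inv u u_neq0 (or_introl erefl).
have invv := inv v v_neq0 (or_intror erefl).
have [uv|uv] := eqVneq (u.1 * v.2) (u.2 * v.1); last first.
  have [/dvd_formP [//|r fE] bu] := (invariant_formP _ _ _ _ _ _ u_neq0).1 invu.
  have [fv bv] := (invariant_formP _ _ _ _ _ _ v_neq0).1 invv.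
  have D : u.1 * v.2 - u.2 * v.1 != 0 by rewrite subr_eq0.
  (* Both planes give linear equations in (beta, gamma) with determinant D, solved by Cramer's
     rule. *)
  split.
  - apply: (mulfI D); rewrite mulr0.
    transitivity ((beta * u.1 + gamma * u.2) * v.2
      - (beta * v.1 + gamma * v.2) * u.2); first ring.
    by rewrite bu bv !mul0r subrr.
  - apply: (mulfI D); rewrite mulr0.
    transitivity ((beta * v.1 + gamma * v.2) * u.1
      - (beta * u.1 + gamma * u.2) * v.1); first ring.
    by rewrite bu bv !mul0r subrr.
  (* On the plane of v the product r l_u vanishes, while l_u does not because the normals are not
     parallel; so l_v divides r. *)
  - move/eqP: fv; rewrite fE rmorphM mulf_eq0 => /orP[/eqP|/eqP].
      by move=> /dvd_formP [//|q ->]; exists q; ring.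
    move=> /plane_restr_form_eq0 => /(_ v_neq0) vu; case/eqP: uv.
    by rewrite mulrC -vu mulrC.
have planeE i : meridian_plane (w i) = meridian_plane u.
  have : range (fun i => meridian_plane (w i)) (meridian_plane (w i)) by exists i.
  by rewrite -wE uvE -(plane_eqP _ _ u_neq0 v_neq0).2// => -[].
(* All enumerated planes coincide, so injectivity leaves exactly one, and 2 k = 4. *)
have [i ki] : exists i, k i = 2%N.
  case: n w k w_inj {w_neq0 wE km} planeE k4 => [|[|n]] w k w_inj planeE.
  - by rewrite big_ord0.
  - by rewrite big_ord1 => k4; exists ord0; lia.
  - by have /w_inj : meridian_plane (w ord0) = meridian_plane (w ord_max)
      by rewrite !planeE.
have [_] := km i; rewrite ki => wi2 _.
have invw : invariant_surface chi (meridian_form (w i)).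
  by apply: inv => //; left; apply: planeE.
have [-> -> [r ->]] := dvd_sqr_extactic _ _ _ _ _ _ (w_neq0 i) invw wi2.
split=> //.
have [s _ ->] := parallel_form _ _ u_neq0 (w_neq0 i)
  ((plane_eqP _ _ u_neq0 (w_neq0 i)).1 (esym (planeE i))).
have [t _ ->] := parallel_form _ _ v_neq0 u_neq0
  ((plane_eqP _ _ v_neq0 u_neq0).1 (esym ((plane_eqP _ _ u_neq0 v_neq0).2 uv))).
(* In terms of l_v alone, the divisor is t l_v^2 and the dividend s^2 t^2 r l_v^2. *)
by exists (s ^+ 2 * t *: r); rewrite -!mul_mpolyC; ring.
Qed.

(** The enumeration is a single plane of multiplicity two if the normals are parallel, and two
    simple planes otherwise. *)
Lemma four_meridians_sufficient c : c <> 0 ->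
  f = c *: (meridian_form u * meridian_form v) -> beta = 0 -> gamma = 0 ->
  invariant_meridian_number chi 4 /\
  (invariant_meridian_planes chi
    = [set meridian_plane u; meridian_plane v])%classic.
Proof.
move=> /eqP c_neq0 fE beta0 gamma0.
have invP x : x <> (0, 0) -> invariant_surface chi (meridian_form x) <->
    u.1 * x.2 = u.2 * x.1 \/ v.1 * x.2 = v.2 * x.1.
  move=> x_neq0; rewrite invariant_formP// beta0 gamma0 !mul0r addr0 fE.
  rewrite plane_restrZ rmorphM/=; split=> [[/eqP + _]|uvx].
    rewrite scaler_eq0 (negPf c_neq0)/= mulf_eq0 => /orP[]/eqP.
      by move=> /plane_restr_form_eq0 -/(_ x_neq0) e; left; rewrite mulrC -e mulrC.
    by move=> /plane_restr_form_eq0 -/(_ x_neq0) e; right; rewrite mulrC -e mulrC.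
  split=> //; case: uvx => e.
    rewrite (plane_restr_form_eq0 _ _ x_neq0).2 ?mul0r ?scaler0//.
    by rewrite mulrC -e mulrC.
  rewrite (plane_restr_form_eq0 _ v x_neq0).2 ?mulr0 ?scaler0//.
  by rewrite mulrC -e mulrC.
have planesE : (invariant_meridian_planes chi
    = [set meridian_plane u; meridian_plane v])%classic.
  apply/seteqP; split=> [_ [x [x_neq0 -> /invP]]|_ [] ->].
  - by case=> // /plane_eqP => /(_ _ x_neq0) <-//; [left|right].
  - by apply/invariant_meridian_planeP => //; apply/invP => //; left; rewrite mulrC.
  - by apply/invariant_meridian_planeP => //; apply/invP => //; right; rewrite mulrC.
split=> //.
(* Over the reals x^2 + y^2 vanishes on no meridian plane, so it can stay in the cofactor. *)
have rotation_neq0 x : x <> (0, 0) -> plane_restr x (px ^+ 2 + py ^+ 2) != 0.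
  move=> x_neq0; rewrite plane_restr_sqnorm// scaler_eq0 invr_eq0.
  by rewrite negb_or sqnorm_neq0// expf_neq0 ?transverse_form_neq0.
have extE : extactic chi
    = - c *: (px ^+ 2 + py ^+ 2) * (meridian_form u * meridian_form v).
  by rewrite extactic_meridian beta0 gamma0 fE !scale0r -!mul_mpolyC; ring.
have [uv|uv] := eqVneq (u.1 * v.2) (u.2 * v.1).
  have [s s_neq0 vE] := parallel_form _ _ u_neq0 v_neq0 uv.
  exists 1%N, (fun=> u), (fun=> 2%N); split=> //.
  - by move=> i j _; rewrite !ord1.
  - rewrite planesE -(plane_eqP _ _ u_neq0 v_neq0).2//.
    by apply/seteqP; split=> [_ [] ->|_ [_ _ <-]]; [exists ord0|exists ord0|left].
  (* The ratio s of the two forms is absorbed into the cofactor of l_u^2. *)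
  - move=> _; apply: (@multiplicityP _ _ _ (- (c * s) *: (px ^+ 2 + py ^+ 2))) => //.
      by rewrite extE vE -!mul_mpolyC; ring.
    by rewrite plane_restrZ scaler_eq0 negb_or oppr_eq0 mulf_neq0//= rotation_neq0.
  - by rewrite big_ord1.
have uv' : meridian_plane u <> meridian_plane v.
  by move=> /plane_eqP => /(_ u_neq0 v_neq0) e; rewrite e eqxx in uv.
exists 2%N, (fun i : 'I_2 => if i == ord0 then u else v), (fun=> 1%N); split.
- by move=> i; case: ifP.
- move=> i j; case: (ord2_cases i) => ->; case: (ord2_cases j) => -> //=.
  by move=> /esym.
- by rewrite range_ord2/= planesE.
- move=> i; case: (ord2_cases i) => -> /=.
    apply: (@multiplicityP _ _ _
      (- c *: ((px ^+ 2 + py ^+ 2) * meridian_form v))) => //.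
      by rewrite extE -!mul_mpolyC; ring.
    rewrite plane_restrZ scaler_eq0 negb_or oppr_eq0 c_neq0 rmorphM mulf_neq0//.
      exact: rotation_neq0.
    (* The other form survives restriction because the normals are not parallel. *)
    by apply: contraNneq uv => /plane_restr_form_eq0 => /(_ u_neq0) /eqP.
  apply: (@multiplicityP _ _ _ (- c *: ((px ^+ 2 + py ^+ 2) * meridian_form u))) => //.
    by rewrite extE -!mul_mpolyC; ring.
  rewrite plane_restrZ scaler_eq0 negb_or oppr_eq0 c_neq0 rmorphM mulf_neq0//.
    exact: rotation_neq0.
  apply: contraNneq uv => /plane_restr_form_eq0 => /(_ v_neq0) e.
  by rewrite mulrC -e mulrC.
- by rewrite big_ord_recr big_ord1.
Qed.

End TwoPlanes.

End MeridianPlane.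

Theorem theorem5p4 (R : realType) (a : R) (ha : 1 < a)
    (f K' K : {mpoly R[3]}) (beta gamma : R)
    (hK : K = K' * pz)
    (hdegf : mpoly_deg_le f 2) (hdegK : mpoly_deg_le K 2)
    (chi : vfield R)
    (hchi : chi =
      VField
        (4^-1 *: (K * px) + f * py + beta *: pz)
        (4^-1 *: (K * py) - f * px + gamma *: pz)
        (2^-1 *: (K' * (- (a ^+ 2 *: (px ^+ 2 + py ^+ 2)) + pz ^+ 2
                        + (a ^+ 4)%:MP - 1))
         - 2 * (beta *: px + gamma *: py)
             * (px ^+ 2 + py ^+ 2 - (a ^+ 2)%:MP)))
    (hcubic : cubic_vf chi) (htorus : vf_on_torus a chi)
    (ai bi : 'I_2 -> R) (hab : forall i, (ai i, bi i) <> (0, 0)) :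
  (invariant_meridian_number chi 4 /\
   invariant_meridian_planes chi
     = range (fun i : 'I_2 => meridian_plane (ai i, bi i)))
  <->
  ((exists c : R, c <> 0 /\ f = c *: \prod_(i < 2) (ai i *: px + bi i *: py))
   /\ beta = 0 /\ gamma = 0).
Proof.
rewrite range_ord2 hchi big_ord_recr big_ord1/=.
rewrite (_ : widen_ord _ _ = ord0); last exact: val_inj.
split=> [[num planes]|[[c [c_neq0 fE]] [beta0 gamma0]]].
  exact: (four_meridians_necessary _ _ _ _ _ _ _ _ (hab ord0) (hab ord_max) hdegf num planes).
exact: (four_meridians_sufficient _ _ _ _ _ _ _ _ (hab ord0) (hab ord_max) _ c_neq0 fE
  beta0 gamma0).
Qed.
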